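(* Let $1\leq a<b$ be integers. For $s\in[-1,1]$ let $\gamma_{a,b}^s:[0,1]\to\mathbb{C}$ be the closed curve $\gamma_{a,b}^s(t)=(1-s)\exp(2\pi i a t)+(1+s)\exp(2\pi i b t)$. Then $\mathrm{wind}(\gamma_{a,b}^s,0)=a$ for every $s\in[-1,0)$ and $\mathrm{wind}(\gamma_{a,b}^s,0)=b$ for every $s\in(0,1]$.
   Context: For a closed curve $\gamma:[0,1]\to\mathbb{C}$ and a point $z_0\in\mathbb{C}\setminus\gamma([0,1])$, the winding number is $\mathrm{wind}(\gamma,z_0)=\frac{1}{2\pi i}\int_0^1\frac{\gamma'(t)}{\gamma(t)-z_0}\,dt$. *)

(* Defs.v *)
(* Stdlib real numbers and Coquelicot. *)
From Stdlib Require Export Reals ZArith.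
From Coquelicot Require Export Coquelicot.

Open Scope R_scope.

(* Coquelicot has no complex exponential. *)
Definition Cexp (z : C) : C :=
  Cmult (RtoC (exp (Re z))) (cos (Im z), sin (Im z)).

(* A curve [0,1] -> C is represented by a function R -> C.  Its derivative is
   the derivative of a function of a real variable with values in the real
   normed space C; like [RInt], this operator is total and is meaningful only
   at points of differentiability. *)
Definition curve_derive (g : R -> C) (t : R) : C :=
  iota (T := C_R_CompleteNormedModule)
    (fun l : C => is_derive (K := R_AbsRing) (V := C_R_NormedModule) g t l).

Definition wind_integrand (g : R -> C) (z0 : C) (t : R) : C :=
  Cdiv (curve_derive g t) (Cminus (g t) z0).

Definition wind (g : R -> C) (z0 : C) : C :=
  Cmult (Cinv (Cmult (RtoC (2 * PI)) Ci))
    (RInt (V := C_R_CompleteNormedModule) (wind_integrand g z0) 0 1).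

Definition closed_curve (g : R -> C) : Prop :=
  continuous_on (T := R_UniformSpace) (U := C_UniformSpace)
    (fun t : R => 0 <= t <= 1) g /\ g 0 = g 1.

(* The conditions under which the value of the total operator [wind] is the
   integral defining the winding number.  Differentiability is required only
   inside (0,1): the values of a Riemann integrand at the two end points do not
   matter, so nothing depends on the values of g outside [0,1]. *)
Definition wind_defined (g : R -> C) (z0 : C) : Prop :=
  closed_curve g /\
  (forall t : R, 0 <= t <= 1 -> g t <> z0) /\
  (forall t : R, 0 < t < 1 ->
     ex_derive (K := R_AbsRing) (V := C_R_NormedModule) g t) /\
  ex_RInt (V := C_R_NormedModule) (wind_integrand g z0) 0 1.

Definition gamma (a b : Z) (s t : R) : C :=
  (RtoC (1 - s) * Cexp (RtoC 2 * RtoC PI * Ci * RtoC (IZR a) * RtoC t)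
   + RtoC (1 + s) * Cexp (RtoC 2 * RtoC PI * Ci * RtoC (IZR b) * RtoC t))%C.

(* Main.v *)
(** With [m] the frequency of the dominant term, the curve factors as
    [exp (2 pi i m t) * w t] where [w] is a closed curve in the right half-plane.
    Hence [gamma' / gamma = 2 pi i m + w' / w], and [w' / w] integrates to [0]
    because the principal logarithm of [w] is a primitive with equal values at
    both end points. *)
Require Import Defs.
From Stdlib Require Import Reals ZArith Lra FunctionalExtensionality.
From Coquelicot Require Import Coquelicot.
Open Scope R_scope.

(** Halving the angle reduces this to the vanishing of sine at all integer multiples of pi, negative
    ones included; the frequency difference [n - m] used later can be negative. *)
Lemma cos_2PI_Z (m : Z) : cos (2 * PI * IZR m) = 1.
Proof.
  replace (2 * PI * IZR m) with (2 * (IZR m * PI)) by ring.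
  rewrite cos_2a_sin, (sin_eq_0_1 (IZR m * PI)) by (exists m; reflexivity).
  ring.
Qed.

Lemma sin_2PI_Z (m : Z) : sin (2 * PI * IZR m) = 0.
Proof.
  replace (2 * PI * IZR m) with (2 * (IZR m * PI)) by ring.
  rewrite sin_2a, (sin_eq_0_1 (IZR m * PI)) by (exists m; reflexivity).
  ring.
Qed.

(** Pairing is a linear map from R x R to C, hence its own differential, and the chain rule
    applies. *)
Lemma is_derive_pair (f g : R -> R) (t df dg : R) :
  is_derive f t df -> is_derive g t dg ->
  is_derive (K := R_AbsRing) (V := C_R_NormedModule)
    (fun u => (f u, g u)) t (df, dg).
Proof.
  intros Hf Hg.
  apply (filterdiff_comp_2 (K := R_AbsRing) (T := R_NormedModule)
    (U := R_NormedModule) (V := R_NormedModule) (W := C_R_NormedModule)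
    f g (fun u v => (u, v)) (fun h => scal h df) (fun h => scal h dg)
    (fun u v => (u, v)) Hf Hg).
  apply filterdiff_linear, is_linear_prod.
  - apply is_linear_fst.
  - apply is_linear_snd.
Qed.

Lemma is_derive_fst (f : R -> C) (t : R) (l : C) :
  is_derive (K := R_AbsRing) (V := C_R_NormedModule) f t l ->
  is_derive (fun u => fst (f u)) t (fst l).
Proof.
  intros H.
  apply (filterdiff_comp (K := R_AbsRing) (U := R_NormedModule)
    (V := C_R_NormedModule) (W := R_NormedModule) f fst _ fst H).
  apply filterdiff_linear, is_linear_fst.
Qed.

Lemma is_derive_snd (f : R -> C) (t : R) (l : C) :
  is_derive (K := R_AbsRing) (V := C_R_NormedModule) f t l ->
  is_derive (fun u => snd (f u)) t (snd l).
Proof.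
  intros H.
  apply (filterdiff_comp (K := R_AbsRing) (U := R_NormedModule)
    (V := C_R_NormedModule) (W := R_NormedModule) f snd _ snd H).
  apply filterdiff_linear, is_linear_snd.
Qed.

(** [iota] returns the expected value only once uniqueness is known. Two complex derivatives agree
    because each of their components is a real derivative, which is unique. *)
Lemma curve_derive_unique (f : R -> C) (t : R) (l : C) :
  is_derive (K := R_AbsRing) (V := C_R_NormedModule) f t l ->
  curve_derive f t = l.
Proof.
  intros H.
  apply (iota_unique (V := C_R_CompleteNormedModule)); [|exact H].
  intros k Hk.
  apply injective_projections.
  - rewrite <- (is_derive_unique _ _ _ (is_derive_fst _ _ _ Hk)).
    apply is_derive_unique, is_derive_fst, H.
  - rewrite <- (is_derive_unique _ _ _ (is_derive_snd _ _ _ Hk)).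
    apply is_derive_unique, is_derive_snd, H.
Qed.

Lemma closed_curve_derivable (g : R -> C) :
  (forall t, ex_derive (K := R_AbsRing) (V := C_R_NormedModule) g t) ->
  g 0 = g 1 -> closed_curve g.
Proof.
  intros Hd Hg. split; [|exact Hg].
  apply continuous_on_forall. intros t _.
  exact (ex_derive_continuous (K := R_AbsRing) (V := C_R_NormedModule) g t (Hd t)).
Qed.

(** Positivity of [x] keeps w = (x, y) off the cut of the principal logarithm, so that
    [atan (y / x)] is a smooth argument of w along the whole curve. Continuity of [dx] and [dy]
    allows the fundamental theorem of calculus. *)
Lemma wind_rotating_right_half_plane (m : Z) (x y dx dy : R -> R) :
  (forall t, is_derive x t (dx t)) -> (forall t, is_derive y t (dy t)) ->
  (forall t, continuous dx t) -> (forall t, continuous dy t) ->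
  (forall t, 0 < x t) -> x 0 = x 1 -> y 0 = y 1 ->
  let g t := Cmult (cos (2 * PI * IZR m * t), sin (2 * PI * IZR m * t)) (x t, y t) in
  wind_defined g (RtoC 0) /\ wind g (RtoC 0) = RtoC (IZR m).
Proof.
  intros Hx Hy Cdx Cdy Hpos x01 y01 g.
  set (mu := 2 * PI * IZR m) in *.
  pose (n2 t := x t * x t + y t * y t).
  assert (Dx : forall t, Derive (fun u => x u) t = dx t).
  { intros t. apply is_derive_unique, Hx. }
  assert (Dy : forall t, Derive (fun u => y u) t = dy t).
  { intros t. apply is_derive_unique, Hy. }
  assert (Hn2 : forall t, 0 < n2 t).
  { intros t. unfold n2. specialize (Hpos t). nra. }
  assert (trig : forall t, cos (mu * t) * cos (mu * t) + sin (mu * t) * sin (mu * t) = 1).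
  { intros t. pose proof (sin2_cos2 (mu * t)) as H. unfold Rsqr in H. lra. }
  (* Product rule: the derivative of exp(i mu t) w is exp(i mu t) (w' + i mu w), and i mu w = (-mu
     y, mu x). *)
  assert (Dg : forall t, is_derive (K := R_AbsRing) (V := C_R_NormedModule) g t
     (Cmult (cos (mu * t), sin (mu * t)) (dx t - mu * y t, dy t + mu * x t))).
  { intros t.
    assert (ex_derive x t) by (eexists; apply Hx).
    assert (ex_derive y t) by (eexists; apply Hy).
    apply is_derive_pair; simpl; auto_derive; auto;
      rewrite Dx, Dy; ring. }
  assert (g_neq0 : forall t, g t <> RtoC 0).
  { intros t H. unfold g, Cmult in H. simpl in H.
    injection H as H1 H2.
    assert (x t = 0); [|specialize (Hpos t); lra].
    (* Multiplying [g t] by the conjugate of the unit rotating factor gives back w, whose real part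
       is [x t]. *)
    replace (x t) with ((cos (mu * t) * cos (mu * t) + sin (mu * t) * sin (mu * t)) * x t)
      by (rewrite trig; ring).
    replace (_ * x t) with
      (cos (mu * t) * (cos (mu * t) * x t - sin (mu * t) * y t) +
       sin (mu * t) * (cos (mu * t) * y t + sin (mu * t) * x t)) by ring.
    rewrite H1, H2. ring. }
  (* This is i mu + w'/w in real and imaginary parts, with w'/w written as w' conj(w) / |w|^2. *)
  pose (q t := ((x t * dx t + y t * dy t) / n2 t, mu + (x t * dy t - y t * dx t) / n2 t)).
  assert (Hint : forall t, wind_integrand g (RtoC 0) t = q t).
  { intros t. unfold wind_integrand.
    rewrite (curve_derive_unique _ _ _ (Dg t)).
    replace (g t - RtoC 0)%C with (g t) by ring.
    transitivity (Cdiv (Cmult (q t) (g t)) (g t)); [f_equal|].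
    - pose proof (Hn2 t). unfold q, g, Cmult, n2 in *; simpl.
      f_equal; field; lra.
    - field. apply g_neq0. }
  assert (cx : forall t, continuous x t).
  { intros t. apply (ex_derive_continuous (V := R_NormedModule)). eexists; apply Hx. }
  assert (cy : forall t, continuous y t).
  { intros t. apply (ex_derive_continuous (V := R_NormedModule)). eexists; apply Hy. }
  assert (cn2 : forall t, continuous (fun u => / n2 u) t).
  { intros t. apply continuous_Rinv_comp.
    - apply (continuous_plus (V := R_NormedModule));
        apply (continuous_mult (K := R_AbsRing)); auto.
    - specialize (Hn2 t). lra. }
  assert (I1 : is_RInt (V := R_NormedModule)
     (fun t => (x t * dx t + y t * dy t) / n2 t) 0 1 0).
  (* The primitive is ln |w|, the real part of log w; it takes equal values at 0 and 1. *)
  { pose (F t := / 2 * ln (n2 t)).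
    assert (HF : minus (F 1) (F 0) = 0)
      by (unfold F, n2, minus, plus, opp; simpl; rewrite x01, y01; ring).
    refine (eq_ind _ (is_RInt (V := R_NormedModule) _ 0 1) _ _ HF).
    apply (is_RInt_derive (V := R_CompleteNormedModule)); intros t _.
    - assert (ex_derive x t) by (eexists; apply Hx).
      assert (ex_derive y t) by (eexists; apply Hy).
      pose proof (Hn2 t). unfold F, n2 in *.
      auto_derive; [repeat split; auto|].
      rewrite Dx, Dy. field. lra.
    - apply (continuous_mult (K := R_AbsRing)); [|apply cn2].
      apply (continuous_plus (V := R_NormedModule));
        apply (continuous_mult (K := R_AbsRing)); auto. }
  assert (I2 : is_RInt (V := R_NormedModule)
     (fun t => mu + (x t * dy t - y t * dx t) / n2 t) 0 1 mu).
  (* The primitive is the total argument mu t + arg w. Since w is closed, only the linear term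
     contributes. *)
  { pose (F t := mu * t + atan (y t / x t)).
    assert (HF : minus (F 1) (F 0) = mu)
      by (unfold F, minus, plus, opp; simpl; rewrite x01, y01; ring).
    refine (eq_ind _ (is_RInt (V := R_NormedModule) _ 0 1) _ _ HF).
    apply (is_RInt_derive (V := R_CompleteNormedModule)); intros t _.
    - assert (ex_derive x t) by (eexists; apply Hx).
      assert (ex_derive y t) by (eexists; apply Hy).
      pose proof (Hn2 t). pose proof (Hpos t). unfold F, n2 in *.
      auto_derive; [repeat split; auto; lra|].
      rewrite Dx, Dy. field. repeat split; nra.
    - apply (continuous_plus (V := R_NormedModule)); [apply continuous_const|].
      apply (continuous_mult (K := R_AbsRing)); [|apply cn2].
      apply (continuous_minus (V := R_NormedModule));
        apply (continuous_mult (K := R_AbsRing)); auto. }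
  assert (I : is_RInt (V := C_R_NormedModule) (wind_integrand g (RtoC 0)) 0 1 (0, mu)).
  { apply (is_RInt_ext (V := C_R_NormedModule)) with q.
    - intros t _. symmetry. apply Hint.
    - exact (is_RInt_fct_extend_pair (U := R_NormedModule) (V := R_NormedModule)
        q
        _ _ _ _ I1 I2). }
  assert (g_ex : forall t, ex_derive (K := R_AbsRing) (V := C_R_NormedModule) g t).
  { intros t. eexists. apply Dg. }
  split.
  - split; [|split; [auto|split; [auto|]]].
    + apply closed_curve_derivable; auto.
      unfold g. rewrite x01, y01, Rmult_0_r, Rmult_1_r, cos_0, sin_0.
      unfold mu. rewrite cos_2PI_Z, sin_2PI_Z. reflexivity.
    + eexists. exact I.
  - unfold wind. rewrite (is_RInt_unique (V := C_R_CompleteNormedModule) _ _ _ _ I).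
    pose proof PI_RGT_0.
    replace ((0, mu) : C) with (RtoC (2 * PI) * Ci * RtoC (IZR m))%C
      by (unfold mu, RtoC, Ci, Cmult; simpl; f_equal; ring).
    field. split.
    + intros E. injection E. lra.
    + intros E. apply RtoC_inj in E. lra.
Qed.

(** Factoring out exp(2 pi i m t) leaves w = c + d exp(2 pi i (n - m) t). This is closed because n -
    m is an integer, and its real part is at least c - d > 0. *)
Lemma wind_dominant_frequency (m n : Z) (c d : R) :
  0 <= d < c ->
  let g t :=
    (c * cos (2 * PI * IZR m * t) + d * cos (2 * PI * IZR n * t),
     c * sin (2 * PI * IZR m * t) + d * sin (2 * PI * IZR n * t)) in
  wind_defined g (RtoC 0) /\ wind g (RtoC 0) = RtoC (IZR m).
Proof.
  intros Hcd g.
  set (k := 2 * PI * IZR (n - m)).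
  replace g with (fun t => Cmult (cos (2 * PI * IZR m * t), sin (2 * PI * IZR m * t))
    (c + d * cos (k * t), d * sin (k * t))).
  - apply wind_rotating_right_half_plane with
      (x := fun t => c + d * cos (k * t)) (y := fun t => d * sin (k * t))
      (dx := fun t => - (d * k) * sin (k * t)) (dy := fun t => d * k * cos (k * t)).
    + intros t. auto_derive; auto. ring.
    + intros t. auto_derive; auto. ring.
    + intros t. apply (ex_derive_continuous (V := R_NormedModule)). auto_derive; auto.
    + intros t. apply (ex_derive_continuous (V := R_NormedModule)). auto_derive; auto.
    + intros t. pose proof (COS_bound (k * t)). nra.
    + rewrite Rmult_0_r, Rmult_1_r, cos_0. unfold k. rewrite cos_2PI_Z. reflexivity.
    + rewrite Rmult_0_r, Rmult_1_r, sin_0. unfold k. rewrite sin_2PI_Z. reflexivity.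
  - apply functional_extensionality. intros t. unfold g.
    replace (2 * PI * IZR n * t) with (2 * PI * IZR m * t + k * t)
      by (unfold k; rewrite minus_IZR; ring).
    rewrite cos_plus, sin_plus. unfold Cmult; simpl. f_equal; ring.
Qed.

Lemma gamma_cos_sin (a b : Z) (s : R) :
  gamma a b s = fun t =>
    ((1 - s) * cos (2 * PI * IZR a * t) + (1 + s) * cos (2 * PI * IZR b * t),
     (1 - s) * sin (2 * PI * IZR a * t) + (1 + s) * sin (2 * PI * IZR b * t)).
Proof.
  apply functional_extensionality. intros t.
  assert (E : forall m : Z, Cexp (RtoC 2 * RtoC PI * Ci * RtoC (IZR m) * RtoC t)
    = (cos (2 * PI * IZR m * t), sin (2 * PI * IZR m * t))).
  { intros m.
    replace (RtoC 2 * RtoC PI * Ci * RtoC (IZR m) * RtoC t)%C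
      with ((0, 2 * PI * IZR m * t) : C)
      by (unfold RtoC, Ci, Cmult; simpl; f_equal; ring).
    unfold Cexp; simpl. rewrite exp_0. apply Cmult_1_l. }
  unfold gamma. rewrite !E. unfold Cplus, Cmult; simpl. f_equal; ring.
Qed.

Theorem theorem1 (a b : Z) (ha : (1 <= a)%Z) (hab : (a < b)%Z) :
  (forall s : R, -1 <= s <= 1 -> closed_curve (gamma a b s)) /\
  (forall s : R, -1 <= s < 0 ->
     wind_defined (gamma a b s) (RtoC 0) /\
     wind (gamma a b s) (RtoC 0) = RtoC (IZR a)) /\
  (forall s : R, 0 < s <= 1 ->
     wind_defined (gamma a b s) (RtoC 0) /\
     wind (gamma a b s) (RtoC 0) = RtoC (IZR b)).
Proof.
  repeat apply conj; intros s Hs; rewrite gamma_cos_sin.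
  (* This covers s = 0 too, where neither frequency dominates. *)
  - apply closed_curve_derivable.
    + intros t. eexists. apply is_derive_pair; auto_derive; auto.
    + rewrite !Rmult_0_r, !Rmult_1_r, cos_0, sin_0, !cos_2PI_Z, !sin_2PI_Z. reflexivity.
  (* For s < 0 the frequency a dominates: 0 <= 1 + s < 1 - s. *)
  - apply wind_dominant_frequency. lra.
  (* For s > 0 the frequency b dominates, so the summands are swapped to put it first. *)
  - replace (fun t => _) with (fun t : R =>
      ((1 + s) * cos (2 * PI * IZR b * t) + (1 - s) * cos (2 * PI * IZR a * t),
       (1 + s) * sin (2 * PI * IZR b * t) + (1 - s) * sin (2 * PI * IZR a * t)))
      by (apply functional_extensionality; intros t; f_equal; ring).
    apply wind_dominant_frequency. lra.
Qed.
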